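(* Let $n\ge 2$ and let $A$ be a regular compact subset of $\mathbb{R}^n$. If either $\mathrm{supp}\, g_A$ is not convex, or $DA\neq D(\mathrm{conv}\,A)$, then $g_A\neq g_K$ for each convex body $K\subset\mathbb{R}^n$.
   Context: A closed set is regular if it coincides with the closure of its interior. For a compact set $A\subset\mathbb{R}^n$, the covariogram is $g_A(x)=\lambda_n(A\cap(A+x))$, $x\in\mathbb{R}^n$, where $\lambda_n$ is Lebesgue measure. $\mathrm{supp}\,f$ denotes the support of the function $f$, $\mathrm{conv}$ denotes convex hull, and $DA=A+(-A)=\{a-b:a,b\in A\}$ is the difference set of $A$. A convex body is a compact convex set with non-empty interior. *)

(* Defs.v *)
From HB Require Import structures.
From mathcomp Require Import all_boot all_order all_algebra.
From mathcomp Require Import all_classical all_reals all_analysis.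

Set Implicit Arguments.
Unset Strict Implicit.
Unset Printing Implicit Defensive.

Import Order.TTheory GRing.Theory Num.Theory.
Import numFieldNormedType.Exports.

Local Open Scope classical_set_scope.
Local Open Scope ring_scope.

(* MathComp-Analysis has Lebesgue measure on the line only.  Lebesgue measure
   on R^n is built here as the n-fold product of `lebesgue_measure`, first on
   `n.-tuple R` (which carries the product sigma-algebra) and then on row
   vectors (which carry the topology). *)

Section consT.
Context {R : realType} {n : nat}.
Local Notation RT := (measurableTypeR R).
Variable mu : {sigma_finite_measure set (n.-tuple RT) -> \bar R}.

Definition consT (p : RT * n.-tuple RT) : n.+1.-tuple RT :=
  [tuple of p.1 :: p.2].

Definition unconsT (t : n.+1.-tuple RT) : RT * n.-tuple RT :=
  (tnth t ord0, [tuple of behead t]).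

Lemma measurable_consT : measurable_fun [set: RT * n.-tuple RT] consT.
Proof. by apply: measurable_cons. Qed.

Lemma measurable_unconsT : measurable_fun [set: n.+1.-tuple RT] unconsT.
Proof.
apply/measurable_fun_pairP; split.
  exact: measurable_tnth.
exact: measurable_behead.
Qed.

Lemma consTK : cancel consT unconsT.
Proof. by case=> x t; congr pair; exact: val_inj. Qed.

Definition consT_measure : set (n.+1.-tuple RT) -> \bar R :=
  pushforward (lebesgue_measure \x mu)%E consT.

Let consT_measure0 : consT_measure set0 = 0%E.
Proof. by have mf := measurable_consT; exact: measure0. Qed.

Let consT_measure_ge0 A : (0 <= consT_measure A)%E.
Proof. by have mf := measurable_consT; exact: measure_ge0. Qed.

Let consT_measure_sigma_additive : semi_sigma_additive consT_measure.
Proof. by have mf := measurable_consT; exact: measure_semi_sigma_additive. Qed.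

HB.instance Definition _ := isMeasure.Build _ _ _ consT_measure
  consT_measure0 consT_measure_ge0 consT_measure_sigma_additive.

(* The library's sigma-finite structure on `\x` is shadowed by its
   (sub)probability structure, so it cannot be inferred here. *)
Let consT_measure_sigma_finite : sigma_finite setT consT_measure.
Proof.
have /sigma_finiteP[F [FT ndF mF]] := sigma_finiteT (@lebesgue_measure R).
have /sigma_finiteP[G [GT ndG mG]] := sigma_finiteT mu.
exists (fun k => unconsT @^-1` (F k `*` G k)) => [|k].
  apply/esym/seteqP; split=> // t _; rewrite -preimage_bigcup /=.
  have [k _ Fk] : (\bigcup_k F k) (unconsT t).1 by rewrite -FT.
  have [l _ Gl] : (\bigcup_k G k) (unconsT t).2 by rewrite -GT.
  exists (maxn k l) => //; split.
    by move: Fk; exact/subsetPset/ndF/leq_maxl.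
  by move: Gl; exact/subsetPset/ndG/leq_maxr.
have [mFk Fkoo] := mF k; have [mGk Gkoo] := mG k; split.
  rewrite -[X in measurable X]setTI; apply: measurable_unconsT => //.
  exact: measurableX.
rewrite /consT_measure /pushforward -comp_preimage.
rewrite (_ : unconsT \o consT = id) ?preimage_id; last exact/funext/consTK.
by rewrite product_measure1E// lte_mul_pinfty// ge0_fin_numE.
Qed.

HB.instance Definition _ := Measure_isSigmaFinite.Build _ _ _ consT_measure
  consT_measure_sigma_finite.

End consT.

Section lebesgue_measure_rV.
Context {R : realType}.
Local Notation RT := (measurableTypeR R).

Fixpoint lebesgue_measure_tuple (n : nat) :
    {sigma_finite_measure set (n.-tuple RT) -> \bar R} :=
  match n with
  | 0 => [the {sigma_finite_measure set (0.-tuple RT) -> \bar R} of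
          \d_([tuple] : 0.-tuple RT)]
  | m.+1 => [the {sigma_finite_measure set (m.+1.-tuple RT) -> \bar R} of
             consT_measure (lebesgue_measure_tuple m)]
  end.

(* 'rV[R]_n with the Borel sigma-algebra of its topology *)
Definition borel_rV (n : nat) : Type :=
  g_sigma_algebraType (@open 'rV[R]_n).

HB.instance Definition _ n := Measurable.on (borel_rV n).

Definition rV_of_tuple n (t : n.-tuple RT) : borel_rV n :=
  \row_(i < n) tnth t i.

Lemma measurable_rV_of_tuple n :
  measurable_fun [set: n.-tuple RT] (@rV_of_tuple n).
Proof.
apply: (@measurability _ _ _ (borel_rV n) setT _ (@open 'rV[R]_n)) => //.
move=> _ [U Uo <-]; rewrite setTI.
pose box (q : {ffun 'I_n -> rat * rat}) : set (n.-tuple RT) :=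
  [set t | forall i, ratr (q i).1 < tnth t i < ratr (q i).2].
pose F q := if `[< box q `<=` @rV_of_tuple n @^-1` U >] then box q else set0.
have mbox q : measurable (box q).
  rewrite (_ : box q = \bigcap_(i in [set: 'I_n])
      ((@tnth n RT)^~ i @^-1` `](ratr (q i).1 : R), (ratr (q i).2 : R)[)).
    apply: fin_bigcap_measurable => // i _.
    by rewrite -[X in measurable X]setTI; exact: measurable_tnth.
  by apply/seteqP; split => [t tq i _|t tq i];
    have := tq i; rewrite /= in_itv//=; exact.
rewrite (_ : _ @^-1` _ = \bigcup_q F q).
  apply: countable_bigcupT_measurable => // q.
  by rewrite /F; case: ifPn.
apply/seteqP; split => [t Ut|t [q _]]; last first.
  by rewrite /F; case: asboolP => // + tq; exact.
have /nbhs_ballP[e /= e0 eU] : nbhs (rV_of_tuple t : 'rV[R]_n) U.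
  exact: open_nbhs_nbhs.
have /choice[q qP] : forall i, exists q : rat * rat,
    tnth t i - e < ratr q.1 < tnth t i /\ tnth t i < ratr q.2 < tnth t i + e.
  move=> i; have [|q1 q1P] := @rat_in_itvoo R (tnth t i - e) (tnth t i).
    by rewrite ltrBlDr ltrDl.
  have [|q2 q2P] := @rat_in_itvoo R (tnth t i) (tnth t i + e).
    by rewrite ltrDl.
  by exists (q1, q2); rewrite !in_itv/= in q1P q2P.
exists (finfun q) => //; rewrite /F; case: asboolP => [_ i|].
  by rewrite ffunE; have [/andP[_ ->] /andP[-> _]] := qP i.
case=> s sq; apply: eU; split=> // i j.
rewrite /ball/= !mxE; have := sq j; rewrite ffunE.
have [/andP[h1 _] /andP[_ h2]] := qP j => /andP[h3 h4].
by rewrite ltr_distlC (lt_trans h1 h3) (lt_trans h4 h2).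
Qed.

Definition lebesgue_measure_rV n : set (borel_rV n) -> \bar R :=
  pushforward (lebesgue_measure_tuple n) (@rV_of_tuple n).

Let lebesgue_measure_rV0 n : lebesgue_measure_rV (@set0 (borel_rV n)) = 0%E.
Proof. by have mf := @measurable_rV_of_tuple n; exact: measure0. Qed.

Let lebesgue_measure_rV_ge0 n (A : set (borel_rV n)) :
  (0 <= lebesgue_measure_rV A)%E.
Proof. by have mf := @measurable_rV_of_tuple n; exact: measure_ge0. Qed.

Let lebesgue_measure_rV_sigma_additive n :
  semi_sigma_additive (@lebesgue_measure_rV n).
Proof.
by have mf := @measurable_rV_of_tuple n; exact: measure_semi_sigma_additive.
Qed.

HB.instance Definition _ n := isMeasure.Build _ _ _ (@lebesgue_measure_rV n)
  (@lebesgue_measure_rV0 n) (@lebesgue_measure_rV_ge0 n)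
  (@lebesgue_measure_rV_sigma_additive n).

Lemma lebesgue_measure_rV_box n (E : 'I_n -> set RT) :
  (forall i, measurable (E i)) ->
  lebesgue_measure_rV [set v : 'rV[R]_n | forall i, E i (v ord0 i)] =
  (\prod_(i < n) lebesgue_measure (E i))%E.
Proof.
move=> mE; rewrite /lebesgue_measure_rV /pushforward.
transitivity (lebesgue_measure_tuple n [set t | forall i, E i (tnth t i)]).
  congr (_ _); apply/seteqP; split => t tE i; have := tE i;
    by rewrite /= mxE.
elim: n E mE => [|n IH] E mE.
  by rewrite big_ord0 /= diracE mem_set// => -[].
rewrite big_ord_recl -IH//= /consT_measure /pushforward -product_measure1E//.
  congr product_measure1; apply/seteqP; split => [[x t] tE|[x t] [xE tE] i].
    split; first exact: (tE ord0).
    by move=> i; have := tE (lift ord0 i); rewrite tnthS.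
  by case: (unliftP ord0 i) => [j ->|->]; rewrite ?tnthS//; exact: tE.
rewrite (_ : mkset _ = \bigcap_(i in [set: 'I_n])
    ((@tnth n RT)^~ i @^-1` E (lift ord0 i))).
  apply: fin_bigcap_measurable => // i _.
  by rewrite -[X in measurable X]setTI; exact: measurable_tnth.
by apply/seteqP; split => [t tE i _|t tE i]; exact: tE.
Qed.

End lebesgue_measure_rV.

Section covariogram.
Context {R : realType} {n : nat}.
Implicit Types (A : set 'rV[R]_n) (x : 'rV[R]_n).

Definition regular_set A := closure A° = A.

Definition convex_hull A : set 'rV[R]_n := smallest (@convex_set R 'rV[R]_n) A.

Definition convex_body A := [/\ compact A, @convex_set R 'rV[R]_n A & A° !=set0].

Definition translate A x : set 'rV[R]_n := [set a + x | a in A].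

Definition difference_set A : set 'rV[R]_n := [set a - b | a in A & b in A].

(* valued in \bar R, like every measure of the library; the values are finite
   for compact A *)
Definition covariogram A x : \bar R := lebesgue_measure_rV (A `&` translate A x).

Definition supp (f : 'rV[R]_n -> \bar R) : set 'rV[R]_n :=
  closure [set x | f x != 0%E].

End covariogram.

(* Main.v *)
(** The support of [g_A] is [DA] when [A] is compact and regular: [g_A x <> 0]
    forces [A] to meet [A + x], that is [x \in DA], which is closed; conversely
    [a - b] with [a], [b] interior points of [A] makes [A] and [A + (a - b)]
    overlap on an open set, and such differences are dense in [DA].  A convex
    body [K] is regular and [DK] is convex, so [g_A = g_K] makes
    [supp g_A = DA = DK] convex.  Convexity of [DA] in turn gives
    [D (conv A) = DA], because a convex set [C] with [A - b `<=` C] also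
    satisfies [conv A - b `<=` C]. *)
Require Import Defs.
From mathcomp Require Import all_boot all_order all_algebra.
From mathcomp Require Import all_classical all_reals all_analysis.
Import Order.TTheory GRing.Theory Num.Theory.
Import numFieldNormedType.Exports.
Local Open Scope classical_set_scope.
Local Open Scope ring_scope.

(** Trades the bundled coefficient and the boolean membership for plain inequalities and set
    membership. *)
Lemma convex_setP (R : realType) (V : lmodType R) (C : set V) :
  @convex_set R V C <->
  forall (x y : V) (t : R), 0 <= t -> t <= 1 -> C x -> C y ->
    C (t *: x + (1 - t) *: y).
Proof.
split=> [cC x y t t0 t1 Cx Cy|cC x y t].
  by have /set_mem := cC x y (Itv01 t0 t1) (mem_set Cx) (mem_set Cy).
by move=> /set_mem Cx /set_mem Cy; apply/mem_set/cC.
Qed.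

(** An open set contains a ball, and a ball of row vectors is a cube with sides of length [e + e],
    whose measure is a product of positive factors. *)
Lemma lebesgue_measure_rV_open_gt0 (R : realType) (n : nat) (U : set 'rV[R]_n) :
  open U -> U !=set0 -> (0 < @lebesgue_measure_rV R n U)%E.
Proof.
move=> Uo [u Uu].
have /nbhs_ballP[e /= e0 eU] : nbhs u U by exact: open_nbhs_nbhs.
pose I (i : 'I_n) : set (measurableTypeR R) :=
  [set` `]u ord0 i - e, u ord0 i + e[%R].
have boxE : [set v : 'rV[R]_n | forall i, I i (v ord0 i)] = ball u e.
  apply/seteqP; split=> [v vI|v [_ uv] i].
    split=> // i j; rewrite (ord1 i) /ball/=.
    by have := vI j; rewrite /I/= in_itv/= ltr_distlC.
  by have := uv ord0 i; rewrite /I/= in_itv/= /ball/= ltr_distlC.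
have muI i : lebesgue_measure (I i) = (e + e)%:E.
  rewrite lebesgue_measure_itv/= lte_fin ltrBlDr -addrA ltrDl addr_gt0//.
  by rewrite -EFinD opprB addrC addrA subrK.
apply: (@lt_le_trans _ _ (@lebesgue_measure_rV R n (ball u e))); last first.
  apply: le_measure => //; rewrite inE; apply: sub_sigma_algebra => //.
  exact: ball_open.
rewrite -boxE lebesgue_measure_rV_box; last by move=> i; exact: measurable_itv.
rewrite (eq_bigr (fun=> (e + e)%:E)) => [|i _]; last exact: muI.
by rewrite prodEFin lte_fin prodr_gt0// => i _; rewrite addr_gt0.
Qed.

Lemma add_cst_continuous (K : numFieldType) (V : pseudoMetricNormedZmodType K)
    (x : V) : continuous (+%R^~ x).
Proof. by move=> y; apply: cvgD; [exact: cvg_id|exact: cvg_cst]. Qed.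

Section difference_set.
Context {R : realType} {n : nat}.
Implicit Types (A C K : set 'rV[R]_n).

Lemma compact_difference_set A : compact A -> compact (difference_set A).
Proof.
move=> cA.
rewrite (_ : difference_set A = (fun p => p.1 - p.2) @` (A `*` A)).
  apply: continuous_compact; last exact: compact_setX.
  exact/continuous_subspaceT/sub_continuous.
apply/seteqP; split=> [_ [a Aa [b Ab <-]]|_ [[a b] [Aa Ab] <-]].
  by exists (a, b).
by exists a => //; exists b.
Qed.

Lemma compact_translate A x : compact A -> compact (translate A x).
Proof.
move=> cA; apply: continuous_compact => //.
apply: continuous_subspaceT => y.
exact: add_cst_continuous.
Qed.

Lemma supp_covariogram A : compact A -> regular_set A ->
  supp (covariogram A) = difference_set A.
Proof.
move=> cA rA.
have closedD : closed (difference_set A).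
  exact/(compact_closed (@norm_hausdorff _ _))/compact_difference_set.
have measurable_compact B : compact B -> measurable (B : set (borel_rV n)).
  move=> cB; have /closed_openC oB : closed B.
    exact: (compact_closed (@norm_hausdorff _ _)).
  rewrite -[B]setCK; apply: (@measurableC _ (borel_rV n)).
  exact: sub_sigma_algebra.
apply/seteqP; split.
  apply: (subset_trans _ closedD); apply: closureS => x /eqP gx.
  have [[y [Ay [a Aa ay]]]|/nonemptyPn A0] := pselect (A `&` translate A x !=set0).
    by exists y => //; exists a => //; rewrite -ay addrC addKr.
  by exfalso; apply: gx; rewrite /covariogram A0 measure0.
move=> _ [a Aa [b Ab <-]] B nB.
have [[U V] /= [nU nV] UV] :
    nbhs (a, b) [set p : 'rV[R]_n * 'rV[R]_n | B (p.1 - p.2)].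
  exact: (@sub_continuous _ (a, b)).
(* Regularity turns [a] and [b] into limits of interior points, so they can be replaced by nearby
   interior points [u] and [v] with [B (u - v)]. *)
move: Aa Ab; rewrite -{1 2}rA.
move=> /(_ _ nU)[u [Au Uu]] /(_ _ nV)[v [Av Vv]].
exists (u - v); split; last exact: (UV (u, v)).
(* [W] is the interior of [A] met with its translate by [u - v]; it contains [u], since
   [u - (u - v) = v]. *)
pose W : set 'rV[R]_n := A° `&` (fun z => z - (u - v)) @^-1` A°.
have oW : open W.
  apply: openI; first exact: open_interior.
  apply: open_comp; last exact: open_interior.
  by move=> z _; exact: add_cst_continuous.
rewrite /= gt_eqF// (lt_le_trans (@lebesgue_measure_rV_open_gt0 _ _ W oW _))//.
  by exists u; split=> //=; rewrite subKr.
apply: le_measure; rewrite ?inE.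
- exact: sub_sigma_algebra.
- by apply: measurableI; apply: measurable_compact => //; exact: compact_translate.
move=> z [/interior_subset Az /interior_subset Azuv]; split=> //.
by exists (z - (u - v)) => //; rewrite subrK.
Qed.

(** The homothety with centre [x] in [K] and ratio [t] sends a ball around an interior point [y] to
    a ball inside [K], whose centre is close to [x] for small [t]. *)
Lemma convex_body_regular K : convex_body K -> regular_set K.
Proof.
move=> [cK /convex_setP convK [y /nbhs_ballP[r /= r0 yrK]]].
apply/seteqP; split.
  apply: subset_trans _ (compact_closed (@norm_hausdorff _ _) cK).
  by apply: closureS; exact: interior_subset.
move=> x Kx B /nbhs_ballP[e /= e0 xeB].
have d0 : 0 < e + `|y - x| by rewrite ltr_wpDr.
(* Chosen so that [0 < t <= 1] and the displacement [t * |y - x|] stays below [e], even when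
   [y = x]. *)
pose t := e / (e + `|y - x|).
have t0 : 0 < t by rewrite divr_gt0.
have t1 : t <= 1 by rewrite ler_pdivrMr// mul1r lerDl.
exists (t *: y + (1 - t) *: x); split.
  apply/nbhs_ballP; exists (t * r) => /=; first exact: mulr_gt0.
  move=> w; rewrite -ball_normE/= => wball.
  (* The preimage of [w] under the homothety; it lies within [r] of [y]. *)
  pose y' := t^-1 *: (w - (1 - t) *: x).
  have -> : w = t *: y' + (1 - t) *: x.
    by rewrite scalerA divff ?gt_eqF// scale1r subrK.
  apply: convK => //; first exact: ltW.
  apply: yrK; rewrite -ball_normE/=.
  have -> : y - y' = t^-1 *: (t *: y + (1 - t) *: x - w).
    by rewrite -addrA -[_ - w]opprB scalerBr scalerA mulVf ?gt_eqF// scale1r.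
  by rewrite normrZ gtr0_norm ?invr_gt0// mulrC ltr_pdivrMr// mulrC.
apply: xeB; rewrite -ball_normE/=.
have -> : x - (t *: y + (1 - t) *: x) = t *: (x - y).
  by rewrite scalerBl scale1r scalerBr opprD opprB addrCA [x + _]addrC
    subrK addrC.
rewrite normrZ gtr0_norm// distrC /t mulrAC ltr_pdivrMr// ltr_pM2l//.
by rewrite ltrDr.
Qed.

Lemma convex_difference_set C :
  @convex_set R 'rV[R]_n C -> @convex_set R 'rV[R]_n (difference_set C).
Proof.
move=> /convex_setP cC; apply/convex_setP.
move=> _ _ t t0 t1 [a Ca [b Cb <-]] [c Cc [d Cd <-]].
exists (t *: a + (1 - t) *: c); first exact: cC.
exists (t *: b + (1 - t) *: d); first exact: cC.
by rewrite !scalerBr opprD addrACA.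
Qed.

Lemma convex_hull_ind A C : @convex_set R 'rV[R]_n C -> A `<=` C ->
  convex_hull A `<=` C.
Proof. by move=> cC AC; exact: smallest_sub. Qed.

Lemma difference_set_convex_hull A :
  @convex_set R 'rV[R]_n (difference_set A) ->
  difference_set (convex_hull A) = difference_set A.
Proof.
move=> /convex_setP cD; apply/seteqP; split; last first.
  move=> _ [a Aa [b Ab <-]].
  by exists a; [exact: sub_gen_smallest|exists b => //; exact: sub_gen_smallest].
(* The hull is taken one argument at a time. For fixed [b], this set is a translate of [DA], hence
   convex. *)
have DhA b : A b -> convex_hull A `<=` [set a | difference_set A (a - b)].
  move=> Ab; apply: convex_hull_ind => [|a Aa]; last by exists a => //; exists b.
  apply/convex_setP => x y t t0 t1 /= Dx Dy; have := cD _ _ _ t0 t1 Dx Dy.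
  by rewrite !scalerBr addrACA -opprD -scalerDl [t + _]addrC subrK scale1r.
move=> _ [a hAa [b hAb <-]]; move: b hAb.
(* Now [a] is fixed in the hull: the set is the reflected translate [a - DA], again convex, and it
   contains [A] by [DhA]. *)
apply: (@convex_hull_ind A [set b | difference_set A (a - b)]) => [|b Ab].
  apply/convex_setP => x y t t0 t1 /= Dx Dy; have := cD _ _ _ t0 t1 Dx Dy.
  by rewrite !scalerBr addrACA -opprD -scalerDl [t + _]addrC subrK scale1r.
exact: DhA.
Qed.

End difference_set.

Theorem proposition3p2 (R : realType) (n : nat) (n_ge2 : (2 <= n)%N)
    (A : set 'rV[R]_n) (A_compact : compact A) (A_regular : regular_set A)
    (A_bad : ~ @convex_set R 'rV[R]_n (supp (covariogram A)) \/
      difference_set A <> difference_set (convex_hull A))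
    (K : set 'rV[R]_n) (K_body : convex_body K) :
  covariogram A <> covariogram K.
Proof.
move=> gAK; have [K_compact K_convex _] := K_body.
have K_regular := convex_body_regular _ K_body.
have suppA_convex : @convex_set R 'rV[R]_n (supp (covariogram A)).
  by rewrite gAK supp_covariogram//; exact: convex_difference_set.
(* The first alternative contradicts [suppA_convex] directly; in the second, [DA] is convex because
   it equals the support. *)
case: A_bad => // DA; apply: DA.
by rewrite difference_set_convex_hull// -supp_covariogram.
Qed.
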